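(* Let $k\ge3$ and let $G$ be a digraph with vertex set the set of coordinate positions $\{1,\dots,2^k\}$. Let $\alpha,\beta,\gamma,\delta,\alpha',\beta',\gamma',\delta'$ be distinct coordinate positions such that $\{\alpha,\beta,\gamma,\delta\}$, $\{\alpha,\beta,\alpha',\beta'\}$, $\{\alpha,\gamma,\alpha',\gamma'\}$ and $\{\alpha,\delta,\alpha',\delta'\}$ are codewords of the extended Hamming code $\widetilde{\mathcal H}_k$. Suppose that $(\Omega_1^1(1),\Omega_1^2(1),\Omega_1^2(2))=(3,1,2^k-5)$, $\Gamma_2^2=\{\alpha,\alpha'\}$, $\Gamma_1^1=\{\beta,\gamma,\delta\}$, $\Gamma_1^2(\beta)=\{\gamma'\}$, $\Gamma_1^2(\gamma)=\{\delta'\}$, and $\Gamma_1^2(\delta)=V(G)\setminus(\Gamma_2^2\cup\Gamma_1^1\cup\{\gamma',\delta'\})$. Then $\widetilde{\mathcal H}_k$ is a $2$-perfect $G$-code.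
   Context: Binary vectors are identified with their supports. A digraph $G$ is a finite directed graph without loops or multiple edges. With $V(G)=\{1,\dots,n\}$, for $x\in\mathbb{F}_2^n$ let $\langle x\rangle_G$ be the support of $x$ together with all vertices reachable by a directed path from it; $w_G(x)=|\langle x\rangle_G|$, $d_G(x,y)=w_G(x-y)$, and $w_G(v)=w_G(\{v\})$ for a vertex $v$. Let $S_G(x;r)=\{y:d_G(x,y)\le r\}$. A set $C\subseteq\mathbb{F}_2^n$ is an $r$-perfect $G$-code if the spheres $S_G(c;r)$, $c\in C$, are pairwise disjoint and their union is $\mathbb{F}_2^n$. Write $u\sim v$ if $u=v$ or there are directed paths from $u$ to $v$ and from $v$ to $u$; $\bar v$ is the class of $v$. The weighted poset $P_{\tilde\pi}$ induced by $G$ is $V(G)/{\sim}$ with $\bar u\preceq\bar v$ iff $\bar u=\bar v$ or there is a path from some $a\in\bar v$ to some $b\in\bar u$, and weights $\tilde\pi(\bar v)=|\bar v|$. $\Omega_j^\omega(i)$ is the number of order ideals (down-closed subsets) of $P_{\tilde\pi}$ of size $i$ (number of elements of $P_{\tilde\pi}$), total weight $\omega$, with exactly $j$ maximal elements. $\Gamma_i^\omega=\{v\in V(G):|\bar v|=i,\ w_G(v)=\omega\}$, and for $v\in V(G)$, $\Gamma_i^\omega(v)=\{u\in V(G):(u,v)\in E(G)\}\cap\Gamma_i^\omega$. $\widetilde{\mathcal H}_k\subseteq\mathbb{F}_2^{2^k}$ is the extended Hamming code: the null space of the $(k+1)\times2^k$ binary matrix whose first row is all ones and whose remaining $k$ rows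 form the matrix whose $i$-th column is the binary representation of $i-1$. *)

(* Defs.v *)
From HB Require Import structures.
From mathcomp Require Import all_boot all_order all_algebra.

Set Implicit Arguments.
Unset Strict Implicit.
Unset Printing Implicit Defensive.

Import GRing.Theory.
Local Open Scope ring_scope.

(* A digraph on n vertices is an irreflexive [e : rel 'I_n], where [e u v]    *)
(* means that there is an arc from u to v; arcs u -> v and v -> u may both    *)
(* be present.  Vertices are numbered 0, ..., n-1 instead of 1, ..., n.       *)

(* The identification of binary vectors with their supports. *)
Definition supp n (x : 'rV['F_2]_n) : {set 'I_n} := [set i | x 0 i != 0].

Definition bvec n (A : {set 'I_n}) : 'rV['F_2]_n := \row_i (i \in A)%:R.

Section DigraphMetric.
Variables (n : nat) (e : rel 'I_n).

Definition gspan (x : 'rV['F_2]_n) : {set 'I_n} :=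
  [set v | [exists u in supp x, connect e u v]].

Definition gweight (x : 'rV['F_2]_n) : nat := #|gspan x|.

Definition gdist (x y : 'rV['F_2]_n) : nat := gweight (x - y).

Definition vweight (v : 'I_n) : nat := gweight (bvec [set v]).

Definition gsphere (x : 'rV['F_2]_n) (r : nat) : {set 'rV['F_2]_n} :=
  [set y | (gdist x y <= r)%N].

Definition perfect_code (r : nat) (C : {set 'rV['F_2]_n}) : Prop :=
  (forall c c', c \in C -> c' \in C -> c != c' ->
     [disjoint gsphere c r & gsphere c' r])
  /\ \bigcup_(c in C) gsphere c r = [set: 'rV['F_2]_n].

Definition gequiv (u v : 'I_n) : bool :=
  (u == v) || (connect e u v && connect e v u).

Definition gclass (v : 'I_n) : {set 'I_n} := [set u | gequiv v u].

(* The weighted poset induced by the digraph: its elements are the classes,   *)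
(* and the weight of a class is its cardinality.                              *)
Definition gposet : {set {set 'I_n}} := [set gclass v | v : 'I_n].

Definition gle (A B : {set 'I_n}) : bool :=
  (A == B) || [exists a in B, exists b in A, connect e a b].

Definition is_ideal (I : {set {set 'I_n}}) : bool :=
  (I \subset gposet)
  && [forall B in I, forall A in gposet, gle A B ==> (A \in I)].

Definition maximals (I : {set {set 'I_n}}) : {set {set 'I_n}} :=
  [set A in I | [forall B in I, gle A B ==> (B == A)]].

(* [Omega j w i] is the number written $\Omega_j^w(i)$. *)
Definition Omega (j w i : nat) : nat :=
  #|[set I : {set {set 'I_n}} |
      [&& is_ideal I, #|I| == i, (\sum_(A in I) #|A|)%N == w
        & #|maximals I| == j]]|.

(* [Gam i w] is the set written $\Gamma_i^w$, [Gam_at i w v] is its           *)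
(* restriction $\Gamma_i^w(v)$ to in-neighbours of v.                         *)
Definition Gam (i w : nat) : {set 'I_n} :=
  [set v | (#|gclass v| == i) && (vweight v == w)].

Definition Gam_at (i w : nat) (v : 'I_n) : {set 'I_n} :=
  [set u | e u v] :&: Gam i w.

End DigraphMetric.

(* Since coordinates are numbered from 0, column j holds the binary digits of *)
(* j itself, least significant digit first; reordering these k rows does not  *)
(* change the null space.                                                     *)
Definition ext_hamming_mx (k : nat) : 'M['F_2]_(1 + k, 2 ^ k) :=
  col_mx (const_mx 1)
         (\matrix_(i < k, j < 2 ^ k) (odd (j %/ 2 ^ i))%:R).

Definition ext_hamming (k : nat) : {set 'rV['F_2]_(2 ^ k)} :=
  [set x | ext_hamming_mx k *m x^T == 0].

(* Main.v *)
Require Import Defs.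
From HB Require Import structures.
From mathcomp Require Import all_boot all_order all_algebra.

Set Implicit Arguments.
Unset Strict Implicit.
Unset Printing Implicit Defensive.

Import GRing.Theory.
Local Open Scope ring_scope.

(** Let h_v be the column of the parity-check matrix H at position v.  A set of
    words of the form ker H is r-perfect as soon as every syndrome is taken
    exactly once on the ball of radius r around 0, for then each coset of the
    code meets this ball in one word ([perfect_code_leaders]).

    The hypotheses on the digraph determine reachability completely: from v one
    reaches only v and one more vertex [tail v], which is v itself for v = be,
    ga, de, is the other vertex of the pair for v = al, al', is be for ga', ga
    for de', and de for all remaining vertices.  So the words of weight at most
    2 are the sets whose union with their image under [tail] has at most two
    elements.  These are the singletons, one for each vertex, and 2^k sets of
    even size, which can be indexed by the vertices as well ([even_leader],
    [small_tail_closureP]).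

    The singleton at v has syndrome h_v, and the even set indexed by v turns out
    to have syndrome h_v + h_de ([sum_even_leader]): for most v that set is
    {v, de}, and where it is not, the codewords {al, be, ga, de},
    {al, ga, al', ga'} and {al, de, al', de'} trade the sum for an available
    one,
      h_al + h_de  = h_be + h_ga,      h_al' + h_de = h_ga' + h_be,
      h_ga' + h_de = h_de' + h_ga,     h_de' + h_de = h_al + h_al',
    the sum for v = de being 0.  As the first row of H is constant and its other
    rows spell the binary digits of the position, the syndromes h_v and
    h_v + h_de are pairwise distinct; there are 2^(k+1) of them, so they are all
    the elements of the syndrome space ([ext_hamming_syndrome_bij]). *)

(** * Words over the two-element field and their syndromes *)

Lemma F2_cases (a : 'F_2) : a = 0 \/ a = 1.
Proof. by case: a => [[|[|m]] lt_m2] //; [left | right]; apply: val_inj. Qed.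

Lemma F2_natr_bool_inj : injective (fun b : bool => b%:R : 'F_2).
Proof. by case=> -[]. Qed.

Lemma supp_bvec n (A : {set 'I_n}) : supp (bvec A) = A.
Proof. by apply/setP=> i; rewrite inE mxE; case: (i \in A). Qed.

Lemma bvec_supp n (x : 'rV['F_2]_n) : bvec (supp x) = x.
Proof.
by apply/rowP=> i; rewrite mxE inE; case: (F2_cases (x 0 i)) => ->.
Qed.

Lemma mulmx_bvec m n (H : 'M['F_2]_(m, n)) (A : {set 'I_n}) :
  H *m (bvec A)^T = \sum_(i in A) col i H.
Proof.
apply/colP=> j; rewrite mxE summxE [RHS]big_mkcond /=.
apply: eq_bigr => i _; rewrite !mxE.
by case: (i \in A); rewrite ?mulr1 ?mulr0.
Qed.

Lemma sum_set2 (T : finType) (V : nmodType) (h : T -> V) (a b : T) :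
  a != b -> \sum_(i in [set a; b]) h i = h a + h b.
Proof. by move=> neq_ab; rewrite big_setU1 ?inE // big_set1. Qed.

(** In characteristic 2, a four-term relation trades a sum of two of its terms
    for the sum of the other two; the second and third identities combine two
    such relations. *)
Lemma F2_swaps m (a b c d a' c' d' : 'cV['F_2]_m) :
    a + b + c + d = 0 -> a + c + a' + c' = 0 -> a + d + a' + d' = 0 ->
  [/\ b + c = a + d, c' + b = a' + d, d' + c = c' + d, a + a' = d' + d
    & d + d = 0].
Proof.
move=> /colP s1 /colP s2 /colP s3.
split; apply/colP=> i; move: (s1 i) (s2 i) (s3 i); rewrite !mxE;
  case: (F2_cases (a i 0)) => ->; case: (F2_cases (b i 0)) => ->;
  case: (F2_cases (c i 0)) => ->; case: (F2_cases (d i 0)) => ->;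
  case: (F2_cases (a' i 0)) => ->; case: (F2_cases (c' i 0)) => ->;
  case: (F2_cases (d' i 0)) => ->;
  first [by [] | by move=> *; apply/eqP].
Qed.

(** * Perfect codes from systems of coset leaders *)

(** Two code words whose balls share y differ from y by leaders with the same
    syndrome; conversely y differs from the code by the leader that has the
    syndrome of y. *)
Lemma perfect_code_leaders n (e : rel 'I_n) r m (H : 'M['F_2]_(m, n))
    (J : finType) (L : J -> 'rV['F_2]_n) :
    (forall x, reflect (exists j, x = L j) (gweight e x <= r)%N) ->
    bijective (fun j => H *m (L j)^T) ->
  perfect_code e r [set x | H *m x^T == 0].
Proof.
move=> ballP [g gK Kg]; split=> [c c' |].
  rewrite !inE => /eqP Hc /eqP Hc'; apply: contraNT.
  case/pred0Pn=> y /andP[]; rewrite !inE => /ballP[i ci] /ballP[j cj].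
  have cE x l : x - y = L l -> x = y + L l.
    by move/(canRL (subrK y)); rewrite addrC.
  have syn x l : H *m x^T = 0 -> x - y = L l -> H *m (L l)^T = - (H *m y^T).
    by move=> Hx <-; rewrite linearB mulmxBr Hx sub0r.
  have ij : i = j by apply: (can_inj gK); rewrite (syn c) // (syn c').
  by rewrite (cE _ _ ci) (cE _ _ cj) ij.
apply/setP=> y; rewrite inE; apply/bigcupP.
pose l := g (- (H *m y^T)).
exists (y + L l); first by rewrite inE linearD mulmxDr Kg subrr.
by rewrite inE /gdist [y + _]addrC addrK; apply/ballP; exists l.
Qed.

(** * Columns of the extended Hamming matrix *)

Lemma odd_divn_expn_inj k : forall m n,
    (m < 2 ^ k)%N -> (n < 2 ^ k)%N ->
    (forall i, (i < k)%N -> odd (m %/ 2 ^ i) = odd (n %/ 2 ^ i)) ->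
  m = n.
Proof.
elim: k => [|k IHk] m n; first by case: m n => [|m] [|n].
move=> ltm ltn bits.
have half_lt p : (p < 2 ^ k.+1)%N -> (p./2 < 2 ^ k)%N.
  by rewrite -divn2 ltn_divLR // -expnSr.
have := bits 0%N isT; rewrite expn0 !divn1 => odd_mn.
rewrite -(odd_double_half m) -(odd_double_half n) odd_mn.
congr (_ + _.*2)%N; apply: IHk => [||i lt_ik]; try exact: half_lt.
by have := bits i.+1 lt_ik; rewrite expnS !divnMA !divn2.
Qed.

Lemma col_ext_hamming_top k (v : 'I_(2 ^ k)) :
  col v (ext_hamming_mx k) (lshift k 0) 0 = 1.
Proof. by rewrite mxE col_mxEu mxE. Qed.

Lemma col_ext_hamming_inj k :
  injective (fun v : 'I_(2 ^ k) => col v (ext_hamming_mx k)).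
Proof.
move=> v w /colP eq_vw; apply: val_inj.
apply: (@odd_divn_expn_inj k) => [||i lt_ik]; try exact: ltn_ord.
have := eq_vw (rshift 1 (Ordinal lt_ik)).
by rewrite mxE [RHS]mxE !col_mxEd mxE [RHS]mxE => /F2_natr_bool_inj.
Qed.

(** The all-ones row separates the columns from the sums of two columns, and
    the other rows separate the columns from each other; surjectivity follows
    by counting. *)
Lemma ext_hamming_syndrome_bij k (d : 'I_(2 ^ k)) :
  bijective (fun p : 'I_(2 ^ k) * bool =>
    col p.1 (ext_hamming_mx k)
      + (if p.2 then col d (ext_hamming_mx k) else 0)).
Proof.
apply: inj_card_bij.
  move=> [v b] [w c] /= eq_syn.
  have eq_bc : b = c.
    have /colP/(_ (lshift k 0)) := eq_syn.
    rewrite mxE [RHS]mxE !col_ext_hamming_top.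
    by case: b c {eq_syn} => -[] //; rewrite col_ext_hamming_top mxE.
  by move: eq_syn; rewrite eq_bc => /addIr/col_ext_hamming_inj->.
by rewrite card_mx card_prod card_bool !card_ord muln1 expnD mulnC.
Qed.

(** * Reachable sets *)

Section Reach.
Variables (n : nat) (e : rel 'I_n).

Lemma vweightE v : vweight e v = #|[set u | connect e v u]|.
Proof.
rewrite /vweight /gweight /gspan supp_bvec; apply: eq_card => u; rewrite !inE.
by apply/exists_inP/idP => [[w /set1P->] | evu] //; exists v; rewrite ?inE.
Qed.

Lemma gspan_tail (t : 'I_n -> 'I_n) (x : 'rV['F_2]_n) :
    (forall v, [set u | connect e v u] = [set v; t v]) ->
  gspan e x = supp x :|: t @: supp x.
Proof.
move=> reachE; apply/setP=> u; rewrite in_setU inE.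
have vuE v : connect e v u = (u == v) || (u == t v).
  by have /setP/(_ u) := reachE v; rewrite !inE.
apply/exists_inP/orP=> [[v xv] | [xu | /imsetP[v xv ->]]].
- by rewrite vuE => /orP[/eqP-> | /eqP->]; [left | right; apply: imset_f].
- by exists u; rewrite ?connect0.
- exists v => //; have /setP/(_ (t v)) := reachE v.
  by rewrite !inE eqxx orbT.
Qed.

(** When the class of v fills the whole reachable set, everything reachable
    from v is equivalent to v and so has the same class and weight. *)
Lemma reach_sub_Gam i v :
  v \in Gam e i i -> [set u | connect e v u] \subset Gam e i i.
Proof.
rewrite inE vweightE => /andP[/eqP cl_v /eqP w_v].
have connE : gclass e v = [set u | connect e v u].
  apply/eqP; rewrite eqEcard cl_v w_v leqnn andbT; apply/subsetP=> u.
  by rewrite !inE => /orP[/eqP<- | /andP[]].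
apply/subsetP=> u; rewrite -connE inE => vu.
have [evu euv] : connect e v u /\ connect e u v.
  by case/orP: vu => [/eqP<- | /andP[]].
have same w : connect e u w = connect e v w.
  by apply/idP/idP; apply: connect_trans.
rewrite inE vweightE -{1}cl_v -w_v; apply/andP; split; apply/eqP.
  apply: eq_card => w; rewrite !inE /gequiv same.
  have -> : connect e w u = connect e w v.
    by apply/idP/idP=> /connect_trans; apply.
  case: (eqVneq u w) => [<- | _]; first by rewrite evu euv !orbT.
  by case: (eqVneq v w) => [<- | _]; rewrite ?connect0.
by apply: eq_card => w; rewrite !inE same.
Qed.

Lemma reach_Gam i v :
  v \in Gam e i i -> #|Gam e i i| = i -> [set u | connect e v u] = Gam e i i.
Proof.
move=> Gv cardG; apply/eqP; rewrite eqEcard reach_sub_Gam //= cardG.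
by move: Gv; rewrite inE vweightE => /andP[_ /eqP->].
Qed.

Lemma reach_Gam11 v : v \in Gam e 1 1 -> [set u | connect e v u] = [set v].
Proof.
rewrite inE vweightE => /andP[_ /eqP w1]; apply/esym/eqP.
by rewrite eqEcard cards1 w1 andbT sub1set inE connect0.
Qed.

(** Already u and v, distinct as there are no loops, exhaust the weight of u. *)
Lemma reach_Gam_at12 u v :
    irreflexive e -> u \in Gam_at e 1 2 v ->
  [set w | connect e u w] = [set u; v].
Proof.
move=> e_irr; rewrite !inE vweightE => /and3P[euv _ /eqP w2].
have neq_uv : u != v by apply: contraTneq euv => <-; rewrite e_irr.
apply/esym/eqP; rewrite eqEcard cards2 neq_uv w2 andbT.
apply/subsetP=> w; rewrite !inE.
by case/orP=> /eqP->; rewrite ?connect0 ?(connect1 euv).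
Qed.

End Reach.

(** * The sets of weight at most two *)

Section Leaders.
Variables (T : finType) (al be ga de al' ga' de' : T).
Hypothesis dist : uniq [:: al; be; ga; de; al'; ga'; de'].

Definition tail (v : T) : T :=
  if v == al then al' else if v == al' then al else
  if v == be then be else if v == ga then ga else
  if v == ga' then be else if v == de' then ga else de.

(** Apart from [set0], these are the three pairs of fixed points of [tail] and
    the pairs [set v; tail v].  The indexing makes the syndrome of the set with
    index v equal to the sum of the columns at v and de. *)
Definition even_leader (v : T) : {set T} :=
  if v == de then set0 else if v == al then [set be; ga] else
  if v == al' then [set ga'; be] else if v == ga' then [set de'; ga] else
  if v == de' then [set al; al'] else [set v; de].

(** The seven points being distinct, every test [x == y] between two of them is
    decided; the proofs below run through the position of a vertex among the
    seven and evaluate [tail] and [even_leader] there. *)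
Ltac split_distinct :=
  let distinct := fresh in
  have distinct := dist; rewrite /= !inE !negb_or -!andbA in distinct;
  move: distinct; do !(case/andP=> ?); move=> _.

Ltac simp_eq :=
  repeat match goal with
  | |- context [?x == ?x] => rewrite (eqxx x)
  | H : is_true (?x != ?y) |- context [?x == ?y] => rewrite (negbTE H)
  | H : is_true (?x != ?y) |- context [?y == ?x] =>
      rewrite (eq_sym y x) (negbTE H)
  end; rewrite /=.

Ltac cases_on v :=
  case: (eqVneq v al) => ?; try subst v; simp_eq;
  [| case: (eqVneq v be) => ?; try subst v; simp_eq;
  [| case: (eqVneq v ga) => ?; try subst v; simp_eq;
  [| case: (eqVneq v de) => ?; try subst v; simp_eq;
  [| case: (eqVneq v al') => ?; try subst v; simp_eq;
  [| case: (eqVneq v ga') => ?; try subst v; simp_eq;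
  [| case: (eqVneq v de') => ?; try subst v; simp_eq]]]]]].

Lemma tail_fixed v : tail v = v -> v \in [:: be; ga; de].
Proof.
by split_distinct; rewrite /tail !inE; cases_on v; move/eqP; simp_eq.
Qed.

Lemma even_leader_closed v u : u \in even_leader v -> tail u \in even_leader v.
Proof.
split_distinct; rewrite /even_leader; cases_on v; rewrite !inE //;
  by case/orP=> /eqP->; rewrite /tail; simp_eq; rewrite ?orbT.
Qed.

Lemma card_even_leader v : (#|even_leader v| <= 2)%N.
Proof.
rewrite /even_leader; do !case: ifP => _;
  by rewrite ?cards0 ?cards2 ?ltnS ?leq_b1.
Qed.

Lemma pair_tail_even_leader v :
  tail v != v -> exists w, [set v; tail v] = even_leader w.
Proof.
move=> tv.
suff [w /eqP] : exists w, [set v; tail v] == even_leader w by exists w.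
move: tv; split_distinct; rewrite /tail /even_leader.
cases_on v => // _.
(* The remaining v are al, al', ga', de' and the vertices outside the seven. *)
- by exists de'; simp_eq.
- by exists de'; simp_eq; rewrite setUC.
- by exists al'; simp_eq.
- by exists ga'; simp_eq.
by exists v; simp_eq.
Qed.

Lemma pair_fixed_even_leader u v :
    u \in [:: be; ga; de] -> v \in [:: be; ga; de] -> u != v ->
  exists w, [set u; v] = even_leader w.
Proof.
rewrite !inE => u3 v3 neq_uv.
suff [w /eqP] : exists w, [set u; v] == even_leader w by exists w.
move: u3 v3 neq_uv; split_distinct; rewrite /even_leader.
case/or3P=> /eqP-> /or3P[]/eqP->; rewrite ?eqxx // => _.
- by exists al; simp_eq.
- by exists be; simp_eq.
- by exists al; simp_eq; rewrite setUC.
- by exists ga; simp_eq.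
- by exists be; simp_eq; rewrite setUC.
by exists ga; simp_eq; rewrite setUC.
Qed.

(** A set A that satisfies the bound and is neither empty nor a singleton is a
    pair stable under [tail]: it is of the form [set u; tail u], or it consists
    of two fixed points of [tail]. *)
Lemma small_tail_closureP (A : {set T}) :
  reflect (exists v, A = [set v] \/ A = even_leader v)
          (#|A :|: tail @: A| <= 2)%N.
Proof.
apply: (iffP idP) => [small | [v [] ->]]; last 2 first.
- by rewrite imset_set1 cards2; case: (v != tail v).
- rewrite (setUidPl _) ?card_even_leader //.
  by apply/subsetP=> _ /imsetP[u lu ->]; apply: even_leader_closed.
have [A0 | A_gt0] := posnP #|A|.
  by exists de; right; rewrite (cards0_eq A0) /even_leader eqxx.
have le_A : (#|A| <= 2)%N.
  by apply: leq_trans small; rewrite subset_leq_card ?subsetUl.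
have [A1 | neq_A1] := eqVneq #|A| 1%N.
  by have /eqP/cards1P[v ->] := A1; exists v; left.
have A2 : #|A| = 2%N by case: #|A| A_gt0 le_A neq_A1 => [|[|[|]]].
have /setUidPl/subsetP closedA : A :|: tail @: A = A.
  by apply/esym/eqP; rewrite eqEcard subsetUl A2.
have /eqP/cards2P[u [v [neq_uv defA]]] := A2.
have tailA w : w \in A -> (tail w == u) || (tail w == v).
  by move=> Aw; have := closedA _ (imset_f tail Aw); rewrite defA !inE.
suff [w lw] : exists w, A = even_leader w by exists w; right.
have [uA vA] : u \in A /\ v \in A by rewrite defA !inE !eqxx orbT.
have [tu | tu] := eqVneq (tail u) u; last first.
  have tuv : tail u = v by have := tailA _ uA; rewrite (negbTE tu) => /eqP.
  by rewrite defA -tuv; apply: pair_tail_even_leader.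
have [tv | tv] := eqVneq (tail v) v; last first.
  have tvu : tail v = u by have := tailA _ vA; rewrite (negbTE tv) orbF => /eqP.
  by rewrite defA -tvu setUC; apply: pair_tail_even_leader.
by rewrite defA; apply: pair_fixed_even_leader => //; apply: tail_fixed.
Qed.

Lemma sum_even_leader m (h : T -> 'cV['F_2]_m) v :
    h al + h be + h ga + h de = 0 -> h al + h ga + h al' + h ga' = 0 ->
    h al + h de + h al' + h de' = 0 ->
  \sum_(i in even_leader v) h i = h v + h de.
Proof.
move=> rel1 rel2 rel3.
have [bc cb' dc aa' dd] := F2_swaps rel1 rel2 rel3.
split_distinct; rewrite /even_leader; cases_on v;
  by rewrite ?big_set0 ?sum_set2 // eq_sym.
Qed.

End Leaders.

(** * Perfection of the extended Hamming code *)

Lemma ext_hamming_set4 k (a b c d : 'I_(2 ^ k)) :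
    uniq [:: a; b; c; d] -> bvec [set a; b; c; d] \in ext_hamming k ->
  col a (ext_hamming_mx k) + col b (ext_hamming_mx k)
    + col c (ext_hamming_mx k) + col d (ext_hamming_mx k) = 0.
Proof.
rewrite /= !inE !negb_or -!andbA => /and5P[ab ac ad bc /andP[bd]].
rewrite andbT => cd /eqP; rewrite mulmx_bvec => <-.
rewrite -!setUA big_setU1 ?inE ?negb_or ?ab ?ac //=.
by rewrite big_setU1 ?inE ?negb_or ?bc //= sum_set2 // !addrA.
Qed.

Theorem theorem3p14 (k : nat) (hk : (3 <= k)%N)
    (e : rel 'I_(2 ^ k)) (e_irr : irreflexive e)
    (al be ga de al' be' ga' de' : 'I_(2 ^ k))
    (distinct : uniq [:: al; be; ga; de; al'; be'; ga'; de'])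
    (h1 : bvec [set al; be; ga; de] \in ext_hamming k)
    (h2 : bvec [set al; be; al'; be'] \in ext_hamming k)
    (h3 : bvec [set al; ga; al'; ga'] \in ext_hamming k)
    (h4 : bvec [set al; de; al'; de'] \in ext_hamming k)
    (hOmega : (Omega e 1 1 1, Omega e 1 2 1, Omega e 1 2 2)
              = (3, 1, 2 ^ k - 5)%N)
    (hG22 : Gam e 2 2 = [set al; al'])
    (hG11 : Gam e 1 1 = [set be; ga; de])
    (hbe : Gam_at e 1 2 be = [set ga'])
    (hga : Gam_at e 1 2 ga = [set de'])
    (hde : Gam_at e 1 2 de
           = [set: 'I_(2 ^ k)] :\: (Gam e 2 2 :|: Gam e 1 1 :|: [set ga'; de'])) :
  perfect_code e 2 (ext_hamming k).
Proof.
have sub_uniq m := mask_uniq distinct m.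
have uniq7 := sub_uniq [:: true; true; true; true; true; false; true; true].
have reachE v :
    [set u | connect e v u] = [set v; tail al be ga de al' ga' de' v].
  rewrite /tail.
  have card22 : #|Gam e 2 2| = 2%N.
    rewrite hG22 cards2; have := uniq7; rewrite /= !inE !negb_or.
    by case: (al == al'); rewrite ?andbF.
  have [-> | v_al] := eqVneq v al.
    by rewrite (@reach_Gam _ _ 2) ?hG22 ?inE ?eqxx // -hG22.
  have [-> | v_al'] := eqVneq v al'.
    by rewrite (@reach_Gam _ _ 2) ?hG22 ?inE ?eqxx ?orbT // -?hG22 // setUC.
  have reach_sink w : w \in Gam e 1 1 -> [set u | connect e w u] = [set w; w].
    by rewrite setUid; apply: reach_Gam11.
  have [-> | v_be] := eqVneq v be.
    by rewrite reach_sink // hG11 !inE eqxx.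
  have [-> | v_ga] := eqVneq v ga.
    by rewrite reach_sink // hG11 !inE eqxx orbT.
  have [-> | v_ga'] := eqVneq v ga'.
    by rewrite (@reach_Gam_at12 _ _ _ be) // hbe inE.
  have [-> | v_de'] := eqVneq v de'.
    by rewrite (@reach_Gam_at12 _ _ _ ga) // hga inE.
  have [-> | v_de] := eqVneq v de.
    by rewrite reach_sink // hG11 !inE eqxx orbT.
  rewrite (@reach_Gam_at12 _ _ _ de) // hde hG22 hG11 !inE.
  by rewrite !negb_or v_al v_al' v_be v_ga v_de v_ga' v_de'.
pose leader (p : 'I_(2 ^ k) * bool) :=
  if p.2 then even_leader al be ga de al' ga' de' p.1 else [set p.1].
apply: (@perfect_code_leaders _ _ _ _ _ _ (fun p => bvec (leader p))).
  move=> x; rewrite /gweight (gspan_tail _ reachE).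
  apply: (iffP (small_tail_closureP uniq7 _)) => [[v xv] | [[v b] ->]].
    case: xv => xv; [exists (v, false) | exists (v, true)];
    by rewrite -(bvec_supp x) xv.
  by exists v; rewrite supp_bvec; case: b; [right | left].
apply: (eq_bij (ext_hamming_syndrome_bij de)) => -[v []] /=.
  rewrite mulmx_bvec /leader /=; apply/esym/sum_even_leader => //.
  - exact: ext_hamming_set4 (sub_uniq (nseq 4 true)) h1.
  - apply: ext_hamming_set4 h3.
    exact: sub_uniq [:: true; false; true; false; true; false; true].
  apply: ext_hamming_set4 h4.
  exact: sub_uniq [:: true; false; false; true; true; false; false; true].
by rewrite mulmx_bvec big_set1 addr0.
Qed.
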